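(* Let $\mathbb A$ be a finitely generated algebraic structure of finite signature with arithmetic multiplication table. Suppose $\kappa$ is an infinite cardinal such that $2^\kappa=\kappa^+$. Let $D$ be a non-principal ultrafilter on $\kappa$ and let $\mathbb A^*=\prod_{i\in\kappa}\mathbb A/D$ and $\mathbb Z^*=\prod_{i\in\kappa}\mathbb Z/D$ be the corresponding ultrapowers. Then $\mathbb A^*\cong\widetilde{\mathbb A}$, where $\widetilde{\mathbb A}$ denotes the nonstandard model $\mathbb A(\mathbb Z^* )$.
   Context: An absolute interpretation $\Gamma$ of an $L$-structure $\mathbb A$ in a structure $\mathbb B$ is a family of parameter-free formulas of the language of $\mathbb B$: $U_\Gamma(\bar x)$, $E_\Gamma(\bar x,\bar x')$ and $Q_\Gamma$ for each symbol $Q\in L$ (in $n$-tuples of variables), such that $E_\Gamma$ defines an equivalence relation on the set $U_\Gamma(\mathbb B)\subseteq B^n$, the $Q_\Gamma$ define (the preimages of the graphs of) constants, operations and relations on the quotient, and the resulting $L$-structure $\Gamma(\mathbb B)$ is isomorphic to $\mathbb A$. For $\widetilde{\mathbb B}\equiv\mathbb B$ the same formulas define an $L$-structure $\Gamma(\widetilde{\mathbb B})$. A finitely generated structure $\mathbb A$ of finite signature has arithmetic multiplication table if, under a Gödel enumeration of the closed terms in the signature and a finite generating set (every element of $\mathbb A$ being the value of such a term), equality of values of terms in $\mathbb A$, as well as the graphs of the operations and the relations of $\mathbb A$ on the values of terms, are definable by first-order formulas in $\langle\mathbb N;+,\cdot,0,1\rangle$. Such an $\mathbb A$ is absolutely interpretable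 in the ring $\mathbb Z$. For $\widetilde{\mathbb Z}\equiv\mathbb Z$, the nonstandard model $\mathbb A(\widetilde{\mathbb Z})$ is the structure $\Gamma(\widetilde{\mathbb Z})$, where $\Gamma$ is any absolute interpretation of $\mathbb A$ in $\mathbb Z$; up to isomorphism it does not depend on $\Gamma$. *)

(* Defs.v *)
From HB Require Import structures.
From mathcomp Require Import all_boot all_order all_algebra.
From mathcomp Require Import boolp classical_sets functions cardinality filter.
Set Implicit Arguments.
Unset Strict Implicit.
Unset Printing Implicit Defensive.
Import GRing.Theory.
Local Open Scope quotient_scope.
Local Open Scope classical_set_scope.
Local Open Scope card_scope.

(* Finite signatures; constants are function symbols of arity 0. *)
Record signature := Signature {
  fsym : finType;
  far : fsym -> nat;
  rsym : finType;
  rar : rsym -> nat }.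

Record structure (L : signature) := Structure {
  carrier :> Type;
  fint : forall f : fsym L, ('I_(far f) -> carrier) -> carrier;
  rint : forall r : rsym L, ('I_(rar r) -> carrier) -> Prop }.
Arguments fint {L} s f _.
Arguments rint {L} s r _.

(* Terms and formulas whose (free) variables are indexed by an arbitrary type
   V; a quantifier binds the variable None of option V.  Falsum, implication
   and the universal quantifier suffice, since the semantics is classical. *)
Inductive term (L : signature) (V : Type) : Type :=
| Var of V
| App (f : fsym L) of 'I_(far f) -> term L V.
Arguments Var {L V} _.
Arguments App {L V} f _.

Inductive formula (L : signature) (V : Type) : Type :=
| Bot
| Eq of term L V & term L V
| Rel (r : rsym L) of 'I_(rar r) -> term L V
| Imp of formula L V & formula L V
| All of formula L (option V).
Arguments Bot {L V}.
Arguments Eq {L V} _ _.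
Arguments Rel {L V} r _.
Arguments Imp {L V} _ _.
Arguments All {L V} _.

Fixpoint eval (L : signature) (M : structure L) (V : Type) (v : V -> M)
    (t : term L V) : M :=
  match t with
  | Var x => v x
  | App f ts => fint M f (fun j => eval v (ts j))
  end.

Fixpoint sat (L : signature) (M : structure L) (V : Type)
    (phi : formula L V) {struct phi} : (V -> M) -> Prop :=
  match phi with
  | Bot => fun=> False
  | Eq s t => fun v => eval v s = eval v t
  | Rel r ts => fun v => rint M r (fun j => eval v (ts j))
  | Imp p q => fun v => sat p v -> sat q v
  | All p => fun v => forall a : M, sat p (fun x => if x is Some y then v y else a)
  end.

Definition definable (L : signature) (M : structure L) (V : Type)
    (R : (V -> M) -> Prop) : Prop :=
  exists phi : formula L V, forall v : V -> M, sat phi v <-> R v.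

Definition isomorphic (L : signature) (M N : structure L) : Prop :=
  exists h : M -> N,
    [/\ bijective h,
        forall f (x : 'I_(far f) -> M), h (fint M f x) = fint N f (h \o x)
      & forall r (x : 'I_(rar r) -> M), rint M r x <-> rint N r (h \o x)].

Inductive arith_op := Zero | One | Add | Mul.

Definition nat_of_arith_op (o : arith_op) : 'I_4 :=
  match o with Zero => inord 0 | One => inord 1 | Add => inord 2 | Mul => inord 3 end.
Definition arith_op_of_nat (i : 'I_4) : arith_op :=
  match val i with 0 => Zero | 1 => One | 2 => Add | _ => Mul end.
Lemma nat_of_arith_opK : cancel nat_of_arith_op arith_op_of_nat.
Proof. by case; rewrite /arith_op_of_nat /= inordK. Qed.
HB.instance Definition _ := Finite.copy arith_op (can_type nat_of_arith_opK).

Definition arith_arity (o : arith_op) : nat :=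
  match o with Zero | One => 0 | Add | Mul => 2 end.

Definition arith_sig : signature :=
  {| fsym := arith_op; far := arith_arity; rsym := void; rar := of_void nat |}.

Definition arith_structure (R : pzSemiRingType) : structure arith_sig :=
  @Structure arith_sig R
    (fun o => match o return ('I_(arith_arity o) -> R) -> R with
              | Zero => fun=> 0%R
              | One => fun=> 1%R
              | Add => fun x => (x ord0 + x ord_max)%R
              | Mul => fun x => (x ord0 * x ord_max)%R
              end)
    (fun r => of_void _ r).

Definition natS : structure arith_sig := arith_structure nat.
Definition intS : structure arith_sig := arith_structure int.

(* The closed terms in the signature L expanded by m names for generators are
   the elements of term L 'I_m: the variables play the role of the names. *)
Definition generates (L : signature) (A : structure L) (m : nat)
    (g : 'I_m -> A) : Prop :=
  forall a : A, exists t : term L 'I_m, eval g t = a.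

Definition finitely_generated (L : signature) (A : structure L) : Prop :=
  exists (m : nat) (g : 'I_m -> A), generates g.

(* CodeSeq.code is an explicit recursive bijection from seq nat to nat. *)
Fixpoint godel (L : signature) (m : nat) (t : term L 'I_m) : nat :=
  match t with
  | Var i => CodeSeq.code [:: 0; val i]
  | App f ts =>
      CodeSeq.code [:: 1, val (enum_rank f)
                     & [seq godel (ts j) | j <- enum 'I_(far f)]]
  end.

Lemma godel_inj (L : signature) (m : nat) : injective (@godel L m).
Proof.
elim=> [i|f ts IH] [j|g us] /(can_inj CodeSeq.codeK) //=.
  by case=> /val_inj ->.
case=> /val_inj/enum_rank_inj fg; rewrite -{g}fg in us * => E.
congr App; apply/funext => j; apply: IH.
by move/eq_in_map: E => /(_ j); apply; rewrite mem_enum.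
Qed.

Definition arithmetic_table_for (L : signature) (A : structure L) (m : nat)
    (g : 'I_m -> A) : Prop :=
  [/\ definable (M := natS) (fun v : bool -> nat =>
        exists s t : term L 'I_m,
          [/\ v false = godel s, v true = godel t & eval g s = eval g t]),
      forall f : fsym L,
        definable (M := natS) (fun v : option 'I_(far f) -> nat =>
          exists (s : 'I_(far f) -> term L 'I_m) (t : term L 'I_m),
            [/\ forall j, v (Some j) = godel (s j), v None = godel t
              & fint A f (fun j => eval g (s j)) = eval g t])
    & forall r : rsym L,
        definable (M := natS) (fun v : 'I_(rar r) -> nat =>
          exists s : 'I_(rar r) -> term L 'I_m,
            (forall j, v j = godel (s j)) /\
            rint A r (fun j => eval g (s j)))].

Definition arithmetic_multiplication_table (L : signature) (A : structure L) :
    Prop :=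
  exists (m : nat) (g : 'I_m -> A), generates g /\ arithmetic_table_for g.

(* Parameter-free formulas in n-tuples of variables, the variable (j, k) being
   the k-th entry of the j-th tuple; for eqv the two tuples are indexed by
   bool, and in fgraph the tuple None is the output. *)
Record interpretation (L K : signature) := Interpretation {
  dim : nat;
  dom : formula K 'I_dim;
  eqv : formula K (bool * 'I_dim);
  fgraph : forall f : fsym L, formula K (option 'I_(far f) * 'I_dim);
  rgraph : forall r : rsym L, formula K ('I_(rar r) * 'I_dim) }.

Section Interpretation.
Variables (L K : signature) (G : interpretation L K) (B : structure K).

Definition interp_dom : Type :=
  {classic {x : 'I_(dim G) -> B | sat (dom G) x}}.

Definition interp_val (J : Type) (x : J -> interp_dom) :
    J * 'I_(dim G) -> B :=
  fun p => sval (x p.1) p.2.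

Definition interp_eqv : rel interp_dom :=
  fun x y => `[< sat (eqv G) (interp_val (fun b : bool => if b then y else x)) >].

Definition interp_equiv_rel (e : equiv_class_of interp_eqv) :
    equiv_rel interp_dom := EquivRelPack e.

Definition interp_quot (e : equiv_class_of interp_eqv) : Type :=
  {eq_quot (interp_equiv_rel e)}.

Definition interp_pi (e : equiv_class_of interp_eqv) (x : interp_dom) :
    interp_quot e := \pi_({eq_quot (interp_equiv_rel e)}) x.

(* On the domain, the formulas define an equivalence relation and the
   preimages of (graphs of) operations and relations on the quotient. *)
Record interp_admissible : Prop := InterpAdmissible {
  adm_eqv : equiv_class_of interp_eqv;
  adm_fun : forall f : fsym L,
    exists F : ('I_(far f) -> interp_quot adm_eqv) -> interp_quot adm_eqv,
      forall x : option 'I_(far f) -> interp_dom,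
        sat (fgraph G f) (interp_val x) <->
        F (fun j => interp_pi adm_eqv (x (Some j))) = interp_pi adm_eqv (x None);
  adm_rel : forall r : rsym L,
    exists P : ('I_(rar r) -> interp_quot adm_eqv) -> Prop,
      forall x : 'I_(rar r) -> interp_dom,
        sat (rgraph G r) (interp_val x) <->
        P (fun j => interp_pi adm_eqv (x j)) }.

Definition interp_structure (H : interp_admissible) : structure L :=
  @Structure L (interp_quot (adm_eqv H))
    (fun f => sval (cid (adm_fun H f)))
    (fun r => sval (cid (adm_rel H r))).

End Interpretation.

Definition absolute_interpretation (L K : signature) (G : interpretation L K)
    (A : structure L) (B : structure K) : Prop :=
  exists H : interp_admissible G B, isomorphic (interp_structure H) A.

Section Ultrapower.
Variables (I : Type) (D : set_system I) (UD : UltraFilter D).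
Variables (L : signature) (M : structure L).

Definition ultra_seq : Type := {classic (I -> M)}.

Definition ultra_eqv : rel ultra_seq :=
  fun x y => `[< D [set i | x i = y i] >].

Lemma ultra_eqv_class : equiv_class_of ultra_eqv.
Proof.
have FD : Filter D by exact: filter_filter.
split.
- by move=> x; apply/asboolP; apply: filterE.
- by move=> x y; apply/asbool_equiv_eq; split; apply: filterS => i.
- move=> y x z /asboolP xy /asboolP yz; apply/asboolP.
  by apply: filterS2 xy yz => i /= -> ->.
Qed.

Definition ultra_equiv_rel : equiv_rel ultra_seq := EquivRelPack ultra_eqv_class.

Definition ultra_quot : Type := {eq_quot ultra_equiv_rel}.

Definition ultrapower : structure L :=
  @Structure L ultra_quot
    (fun f x => \pi_({eq_quot ultra_equiv_rel})
       (fun i => fint M f (fun j => repr (x j : {eq_quot ultra_equiv_rel}) i)))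
    (fun r x =>
       D [set i | rint M r (fun j => repr (x j : {eq_quot ultra_equiv_rel}) i)]).

End Ultrapower.

Definition card_lt (T U : Type) (A : set T) (B : set U) : Prop :=
  (A #<= B) /\ ~ (B #<= A).

(* The cardinality of B is the least cardinal greater than that of A. *)
Definition card_successor (T U : Type) (A : set T) (B : set U) : Prop :=
  card_lt A B /\ forall (V : Type) (C : set V), card_lt A C -> B #<= C.

(* Main.v *)
(** An interpretation of A in B amounts to a surjective coordinate map from the
    domain of the interpretation onto A along which the defining formulas
    compute equality, operations and relations of A.  By the theorem of Łoś a
    coordinate map for (A, B) lifts to one for the two ultrapowers.

    To interpret A in the ring of integers, relativize the arithmetical
    formulas of the multiplication table to the natural numbers, which are
    defined in the ring by "c^2 n is a sum of four squares for some nonzero c";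
    the coordinate map sends the Gödel number of a closed term to its value. *)

From mathcomp Require Import all_boot all_order all_algebra ring zify.
From mathcomp Require Import boolp classical_sets functions cardinality filter.
Require Import Defs.
Set Implicit Arguments.
Unset Strict Implicit.
Unset Printing Implicit Defensive.
Import Order.TTheory GRing.Theory Num.Theory.
Local Open Scope quotient_scope.
Local Open Scope classical_set_scope.

Lemma isomorphic_sym (L : signature) (M N : structure L) :
  isomorphic M N -> isomorphic N M.
Proof.
case=> h [[k hK kK] hf hr]; exists k; split; first by exists h.
- move=> f x; apply: (can_inj hK); rewrite kK hf; congr fint.
  by apply/funext => j /=; rewrite kK.
- move=> r x; rewrite hr.
  by have -> : h \o (k \o x) = x by apply/funext => j /=; rewrite kK.
Qed.

(** * Coordinate maps *)

(** Formulated on tuples of [B], so that neither the quotient nor the admissibility of [G] is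
    presupposed; both are recovered from [p]. *)
Definition coordinate_map (L K : signature) (G : interpretation L K)
    (A : structure L) (B : structure K) (p : interp_dom G B -> A) : Prop :=
  [/\ forall a, exists x, p x = a,
      forall x : bool -> interp_dom G B,
        sat (eqv G) (interp_val x) <-> p (x false) = p (x true),
      forall f (x : option 'I_(far f) -> interp_dom G B),
        sat (fgraph G f) (interp_val x) <->
        fint A f (fun j => p (x (Some j))) = p (x None)
    & forall r (x : 'I_(rar r) -> interp_dom G B),
        sat (rgraph G r) (interp_val x) <-> rint A r (fun j => p (x j))].

Lemma interp_eqvE (L K : signature) (G : interpretation L K)
    (B : structure K) (x : bool -> interp_dom G B) :
  sat (eqv G) (interp_val x) <-> interp_eqv (x false) (x true).
Proof.
have -> : x = fun b => if b then x true else x false.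
  by apply/funext; case.
by split=> /asboolP.
Qed.

(** The kernel of [p] is the relation defined by [eqv G], so [p] induces a bijection from the
    quotient onto [A], along which the operations and relations of [A] are pulled back. *)
Lemma coordinate_map_interp (L K : signature) (G : interpretation L K)
    (A : structure L) (B : structure K) (p : interp_dom G B -> A) :
  coordinate_map p -> absolute_interpretation G A B.
Proof.
case=> psurj peqv pfun prel.
have pE x y : interp_eqv x y <-> p x = p y.
  have := interp_eqvE (fun b => if b then y else x).
  by rewrite (peqv (fun b => if b then y else x)) /= => ->.
have pC : equiv_class_of (@interp_eqv _ _ G B).
  split.
  - by move=> x; apply/pE.
  - by move=> x y; apply/idP/idP => /pE xy; apply/pE.
  - by move=> y x z /pE xy /pE yz; apply/pE; rewrite xy.
have piE x y : interp_pi pC x = interp_pi pC y <-> p x = p y.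
  rewrite -pE; split.
  - by move=> /(@eqmodP _ (interp_equiv_rel pC) _ _).
  - by move=> xy; apply/(@eqmodP _ (interp_equiv_rel pC) _ _).
pose rep (q : interp_quot pC) : interp_dom G B :=
  repr (q : {eq_quot (interp_equiv_rel pC)}).
have repK q : interp_pi pC (rep q) = q.
  exact: (@reprK _ {eq_quot (interp_equiv_rel pC)}).
have prep x : p (rep (interp_pi pC x)) = p x by apply/piE; rewrite repK.
pose s a : interp_dom G B := sval (cid (psurj a)).
have sK a : p (s a) = a by rewrite /s; case: cid.
have aF f : exists F : ('I_(far f) -> interp_quot pC) -> interp_quot pC,
    forall x : option 'I_(far f) -> interp_dom G B,
        sat (fgraph G f) (interp_val x) <->
        F (fun j => interp_pi pC (x (Some j))) = interp_pi pC (x None).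
  exists (fun q => interp_pi pC (s (fint A f (fun j => p (rep (q j)))))) => x.
  rewrite pfun piE sK.
  by under [in X in _ <-> X]eq_fun do rewrite prep.
have aR r : exists P : ('I_(rar r) -> interp_quot pC) -> Prop,
    forall x : 'I_(rar r) -> interp_dom G B,
        sat (rgraph G r) (interp_val x) <->
        P (fun j => interp_pi pC (x j)).
  exists (fun q => rint A r (fun j => p (rep (q j)))) => x.
  by rewrite prel; under [in X in _ <-> X]eq_fun do rewrite prep.
exists (InterpAdmissible aF aR), (p \o rep); split.
- exists (interp_pi pC \o s) => [q|a] /=; last by rewrite prep sK.
  by rewrite -[RHS]repK; apply/piE; rewrite sK.
- move=> f x /=; case: cid => F /= FP.
  (* The output tuple is the chosen preimage of the value in [A], so the defining formula determines
     the value of [F]. *)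
  have /FP : sat (fgraph G f)
      (interp_val (fun o => if o is Some j then rep (x j)
                            else s (fint A f (p \o rep \o x)))).
    by apply/pfun; rewrite sK.
  under eq_fun do rewrite repK.
  by move=> ->; rewrite prep sK.
- move=> r x /=; case: cid => P /= PP.
  have := PP (rep \o x); under eq_fun do rewrite /= repK.
  by move=> <-; rewrite prel.
Qed.

(** The projection to the quotient followed by the isomorphism onto [A] is such a map. *)
Lemma interp_coordinate_map (L K : signature) (G : interpretation L K)
    (A : structure L) (B : structure K) :
  absolute_interpretation G A B ->
  exists p : interp_dom G B -> A, coordinate_map p.
Proof.
case=> H [h [hbij hf hr]].
have hI := bij_inj hbij.
exists (fun x => h (interp_pi (adm_eqv H) x)); split.
- case: hbij => k hK kK a.
  exists (repr (k a : {eq_quot (interp_equiv_rel (adm_eqv H))})).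
  by rewrite /interp_pi reprK kK.
- move=> x; rewrite interp_eqvE; split.
  + move=> xy; congr h.
    exact/(@eqmodP _ (interp_equiv_rel (adm_eqv H)) _ _).
  + by move=> /hI /(@eqmodP _ (interp_equiv_rel (adm_eqv H)) _ _).
- move=> f x.
  rewrite -[X in X = _](hf f (fun j => interp_pi (adm_eqv H) (x (Some j)))) /=.
  case: cid => F /= FP; rewrite FP.
  by split=> [->|/hI].
- move=> r x.
  rewrite -[X in _ <-> X](hr r (fun j => interp_pi (adm_eqv H) (x j))) /=.
  by case: cid => P /= PP; rewrite PP.
Qed.

(** * The theorem of Łoś *)

Definition ultra_class (I : Type) (D : set_system I) (UD : UltraFilter D)
    (L : signature) (M : structure L) (w : I -> M) : ultrapower UD M :=
  \pi_({eq_quot (ultra_equiv_rel UD M)}) (w : ultra_seq I M).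

Definition ultra_repr (I : Type) (D : set_system I) (UD : UltraFilter D)
    (L : signature) (M : structure L) (a : ultrapower UD M) : I -> M :=
  repr (a : {eq_quot (ultra_equiv_rel UD M)}).

Lemma ultra_reprK (I : Type) (D : set_system I) (UD : UltraFilter D)
    (L : signature) (M : structure L) (a : ultrapower UD M) :
  ultra_class UD (ultra_repr a) = a.
Proof. exact: (@reprK _ {eq_quot (ultra_equiv_rel UD M)}). Qed.

Lemma ultra_classP (I : Type) (D : set_system I) (UD : UltraFilter D)
    (L : signature) (M : structure L) (w w' : I -> M) :
  ultra_class UD w = ultra_class UD w' <-> D [set i | w i = w' i].
Proof.
split=> [/(@eqmodP _ (ultra_equiv_rel UD M) _ _)/asboolP //|E].
by apply/(@eqmodP _ (ultra_equiv_rel UD M) _ _)/asboolP.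
Qed.

Lemma ultra_repr_class (I : Type) (D : set_system I) (UD : UltraFilter D)
    (L : signature) (M : structure L) (w : I -> M) :
  D [set i | ultra_repr (ultra_class UD w) i = w i].
Proof. by apply/(ultra_classP UD); rewrite ultra_reprK. Qed.

(** Finitely many sets of [D] are intersected. Arities and dimensions are finite, so all
    representatives can be exchanged at once. *)
Lemma ultra_repr_class_fin (I : Type) (D : set_system I) (UD : UltraFilter D)
    (L : signature) (M : structure L) (J : finType) (w : J -> I -> M) :
  D [set i | (fun j => ultra_repr (ultra_class UD (w j)) i) = (w^~ i)].
Proof.
have FD : Filter D by exact: filter_filter.
have := @filter_forall _ _ _ D FD (fun j => ultra_repr_class UD (w j)).
apply: filterS => i /= E; apply/funext => j; apply: E.
Qed.

Lemma filter_iff (T : Type) (F : set_system T) (FF : Filter F)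
    (P Q R : set T) :
  F R -> (forall x, R x -> P x <-> Q x) -> F P <-> F Q.
Proof.
by move=> FR PQ; split; apply: filterS2 FR => x Rx; have [] := PQ x Rx.
Qed.

Lemma fint_ultra_class (I : Type) (D : set_system I) (UD : UltraFilter D)
    (L : signature) (M : structure L) (f : fsym L)
    (w : 'I_(far f) -> I -> M) :
  fint (ultrapower UD M) f (fun j => ultra_class UD (w j)) =
  ultra_class UD (fun i => fint M f (w^~ i)).
Proof.
have FD : Filter D by exact: filter_filter.
apply/(@ultra_classP _ _ UD _ M
  (fun i => fint M f (fun j => ultra_repr (ultra_class UD (w j)) i))).
by apply: filterS (ultra_repr_class_fin UD w) => i /= ->.
Qed.

Lemma rint_ultra_class (I : Type) (D : set_system I) (UD : UltraFilter D)
    (L : signature) (M : structure L) (r : rsym L)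
    (w : 'I_(rar r) -> I -> M) :
  rint (ultrapower UD M) r (fun j => ultra_class UD (w j)) <->
  D [set i | rint M r (w^~ i)].
Proof.
have FD : Filter D by exact: filter_filter.
by apply: filter_iff (ultra_repr_class_fin UD w) _ => i /= <-.
Qed.

Lemma eval_ultra_class (I : Type) (D : set_system I) (UD : UltraFilter D)
    (L : signature) (M : structure L) (V : Type) (w : V -> I -> M)
    (t : term L V) :
  eval (fun x => ultra_class UD (w x)) t =
  ultra_class UD (fun i => eval (w^~ i) t).
Proof.
elim: t => [x //|f ts IH].
transitivity (fint (ultrapower UD M) f
    (fun j => ultra_class UD (fun i => eval (w^~ i) (ts j)))).
  congr (fint (ultrapower UD M) f); apply/funext => j; exact: IH.
exact: fint_ultra_class.
Qed.

(** Induction on [phi]. Implication and the universal quantifier both use that [D] contains each set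
    or its complement; the quantifier also needs a choice of counterexamples. *)
Lemma los (I : Type) (D : set_system I) (UD : UltraFilter D)
    (L : signature) (M : structure L) (V : Type) (phi : formula L V)
    (w : V -> I -> M) :
  sat phi (fun x => ultra_class UD (w x)) <-> D [set i | sat phi (w^~ i)].
Proof.
have FD : Filter D by exact: filter_filter.
elim: phi w => {V} [V|V s t|V r ts|V p IHp q IHq|V p IHp] w.
- by split=> // /filter_ex[].
- by rewrite /= !eval_ultra_class ultra_classP.
- rewrite -(rint_ultra_class UD (fun j i => eval (w^~ i) (ts j))).
  have -> : (fun j => ultra_class UD (fun i => eval (w^~ i) (ts j))) =
      fun j => eval (fun x => ultra_class UD (w x)) (ts j).
    by apply/funext => j; rewrite eval_ultra_class.
  by [].
- rewrite /= IHp IHq; split=> [pq|]; last first.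
    by move=> pq Dp; apply: filterS2 pq Dp => i; apply.
  (* If the complement is the set in [D], the implication holds vacuously on it. *)
  have [/pq|] := in_ultra_setVsetC [set i | sat p (w^~ i)] UD.
    by apply: filterS => i qi _.
  by apply: filterS => i np /np.
- have ext (a : I -> M) :
      sat p (fun x => if x is Some y then ultra_class UD (w y)
                      else ultra_class UD a) <->
      D [set i | sat p (fun x => if x is Some y then w y i else a i)].
    have := IHp (fun x => if x is Some y then w y else a).
    rewrite (_ : (fun x : option V => ultra_class UD _) = fun x : option V =>
      if x is Some y then ultra_class UD (w y) else ultra_class UD a).
      move=> ->; rewrite (_ : [set i | _] = [set i | sat p (fun x : option V =>
        if x is Some y then w y i else a i)]) //.
      apply/funext => i /=; congr sat; apply/funext; by case.
    by apply/funext; case.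
  split=> [all|Dall a]; last first.
    rewrite -(ultra_reprK a); apply/ext; apply: filterS Dall => i; exact.
  have [//|Dn] := in_ultra_setVsetC [set i | forall a, sat p
      (fun x => if x is Some y then w y i else a)] UD.
  (* The counterexample [m0] at one coordinate is the default value of [a] at coordinates that have
     none. *)
  have [i0 /= /existsNP [m0 _]] := filter_ex Dn.
  pose bad i m := ~ sat p (fun x => if x is Some y then w y i else m).
  have [a aP] : {a : I -> M & forall i, (exists m, bad i m) -> bad i (a i)}.
    apply: (@choice I M (fun i m => (exists m', bad i m') -> bad i m)) => i.
    by have [[m mP]|n] := pselect (exists m, bad i m); [exists m | exists m0].
  have /ext Da := all (ultra_class UD a).
  (* At a coordinate common to both sets, [a i] satisfies [p] and is a counterexample to it. *)
  have [i [/= si /existsNP ni]] := filter_ex (filterI Da Dn).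
  by case: (aP i).
Qed.

(** The map [q] is computed coordinatewise: by the theorem of Łoś the components of a tuple in the
    domain over the ultrapower lie in the domain over [B] on a set of [D], and applying [p] there
    represents the image. *)
Lemma coordinate_map_ultrapower (L K : signature) (G : interpretation L K)
    (A : structure L) (B : structure K) (p : interp_dom G B -> A)
    (I : Type) (D : set_system I) (UD : UltraFilter D) :
  coordinate_map p ->
  exists q : interp_dom G (ultrapower UD B) -> ultrapower UD A,
    coordinate_map q.
Proof.
have FD : Filter D by exact: filter_filter.
case=> psurj peqv pfun prel.
pose good (x : interp_dom G (ultrapower UD B)) (a : ultrapower UD A) :=
  D [set i | exists2 y : interp_dom G B,
      sval y = (fun k => ultra_repr (sval x k) i) & p y = ultra_repr a i].
have satW V (phi : formula K V) (v : V -> ultrapower UD B) :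
    sat phi v <-> D [set i | sat phi (fun x => ultra_repr (v x) i)].
  by rewrite -los; under [in X in _ <-> X]eq_fun do rewrite ultra_reprK.
have [q qP] : {q & forall x, good x (q x)}.
  apply: choice => x.
  have Dx := proj1 (satW _ _ _) (svalP x).
  (* The components at [i0] form a tuple in the domain; it is the default where the components do
     not. *)
  have [i0 x0] := filter_ex Dx.
  have [w wP] : {w : I -> interp_dom G B & forall i,
      sat (dom G) (fun k => ultra_repr (sval x k) i) ->
      sval (w i) = (fun k => ultra_repr (sval x k) i)}.
    apply: (@choice I (interp_dom G B) (fun i y =>
      sat (dom G) (fun k => ultra_repr (sval x k) i) ->
      sval y = (fun k => ultra_repr (sval x k) i))) => i.
    have [s|n] := pselect (sat (dom G) (fun k => ultra_repr (sval x k) i)).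
      by exists (exist (fun v => sat (dom G) v) _ s).
    by exists (exist (fun v => sat (dom G) v) _ x0).
  exists (ultra_class UD (p \o w)).
  apply: filterS2 Dx (ultra_repr_class UD (p \o w)) => i /= /wP wi ->.
  by exists (w i).
(* A finite family of tuples is treated on a single set of [D], where the clauses for [p] yield
   those for [q] pointwise. *)
have lift (J : finType) (x : J -> interp_dom G (ultrapower UD B)) :
    D [set i | exists y : J -> interp_dom G B,
      interp_val y = (fun z => ultra_repr (interp_val x z) i) /\
      forall j, p (y j) = ultra_repr (q (x j)) i].
  apply: filterS (@filter_forall _ _ _ D FD (fun j => qP (x j))) => i /= E.
  have [y yP] := choice (fun j => let: ex_intro2 y y1 y2 := E j in
    ex_intro (fun y => sval y = (fun k => ultra_repr (sval (x j) k) i) /\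
      p y = ultra_repr (q (x j)) i) y (conj y1 y2)).
  exists y; split=> [|j]; last by case: (yP j).
  apply/funext => -[j k]; rewrite /interp_val /=.
  by case: (yP j) => ->.
exists q; split.
(* Surjectivity: preimages under [p] chosen at each coordinate form a tuple in the domain, again by
   Łoś. *)
- move=> a.
  have [w wP] := choice (fun i => psurj (ultra_repr a i)).
  have dw : sat (dom G) (fun k => ultra_class UD (fun i => sval (w i) k)).
    by apply/los; apply: filterE => i; apply: (svalP (w i)).
  exists (exist (fun v => sat (dom G) v) _ dw).
  rewrite -(ultra_reprK (q _)) -[RHS]ultra_reprK; apply/ultra_classP.
  apply: filterS2 (qP (exist (fun v => sat (dom G) v) _ dw))
    (ultra_repr_class_fin UD (fun k i => sval (w i) k)) => i /= [y ys <-] E.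
  rewrite -wP; congr p; apply: eq_sig_hprop; first by move=> *; exact: Prop_irrelevance.
  by rewrite ys E.
- move=> x; rewrite satW -(ultra_reprK (q (x false))) -(ultra_reprK (q (x true))).
  rewrite ultra_classP; apply: filter_iff (lift _ x) _ => i [y [yv yq]].
  by have := peqv y; rewrite yv !yq.
- move=> f x; rewrite satW -[X in _ <-> _ = X]ultra_reprK.
  rewrite [X in _ <-> X](ultra_classP UD).
  apply: filter_iff (lift _ x) _ => i [y [yv yq]].
  have := pfun f y; rewrite yv yq.
  by have -> : (fun j => p (y (Some j))) =
    fun j => ultra_repr (q (x (Some j))) i by apply/funext => j; rewrite yq.
- move=> r x; rewrite satW.
  apply: filter_iff (lift _ x) _ => i [y [yv yq]].
  have := prel r y; rewrite yv.
  by have -> : (fun j => p (y j)) =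
    fun j => ultra_repr (q (x j)) i by apply/funext => j; rewrite yq.
Qed.

(** * Sums of four squares *)

(** Pigeonhole modulo p = 2h + 1: the h + 1 values x^2 and the h + 1 values -1 - y^2, for x and y at
    most h, cannot all differ, while each family is injective. *)
Lemma prime_dvd_sum2_succ (p : nat) : prime p ->
  exists x y m : nat, [/\ 0 < m, m < p & m * p = x ^ 2 + y ^ 2 + 1].
Proof.
move=> pr_p; have [->|odd_p] := even_prime pr_p; first by exists 1, 0, 1.
have p1 := prime_gt1 pr_p.
set h := p./2; have ph : p = h.*2.+1 by rewrite -[LHS]odd_double_half odd_p.
have dvdE n : (p %| n) = (n%:R == 0 :> 'F_p)%R.
  exact: dvdn_pcharf (pchar_Fp pr_p) n.
have natr_inj (x y : 'I_h.+1) : (x%:R = y%:R :> 'F_p)%R -> x = y.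
  move=> /(congr1 val); rewrite /= !val_Fp_nat // !modn_small; last 2 first.
  - by have := ltn_ord y; lia.
  - by have := ltn_ord x; lia.
  exact: val_inj.
have sqr_inj (x y : 'I_h.+1) : (x%:R ^+ 2 = y%:R ^+ 2 :> 'F_p)%R -> x = y.
  move=> /eqP; rewrite eqf_sqr => /orP[/eqP/natr_inj //|].
  (* If x = -y modulo p, then p divides x + y <= 2h < p, which leaves only x = y = 0. *)
  rewrite -addr_eq0 -natrD -dvdE => pxy; apply: val_inj => /=.
  have [xy0|xy0] := posnP (x + y); first by lia.
  have := dvdn_leq xy0 pxy; have := ltn_ord x; have := ltn_ord y; lia.
pose F (u : 'I_h.+1 + 'I_h.+1) : 'F_p :=
  match u with inl x => (x%:R ^+ 2)%R | inr y => (- 1 - y%:R ^+ 2)%R end.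
have /injectivePn [u [v uv Fuv]] : ~~ injectiveb F.
  apply/negP => /injectiveP /leq_card; rewrite card_Fp // card_sum !card_ord; lia.
have cross (x y : 'I_h.+1) : F (inl x) = F (inr y) ->
    exists x y m : nat, [/\ 0 < m, m < p & m * p = x ^ 2 + y ^ 2 + 1].
  rewrite /F => /eqP E.
  have /dvdnP [m mE] : p %| x ^ 2 + y ^ 2 + 1.
    rewrite dvdE !natrD !natrX -addrA addrC -[X in (_ + X)%R]opprK subr_eq0.
    by move/eqP: E => ->; apply/eqP; rewrite /=; ring.
  exists x, y, m; split=> //.
  - by case: m mE => //; lia.
  (* Here m p = x^2 + y^2 + 1 <= 2 h^2 + 1 < p^2. *)
  - have xh := ltn_ord x; have yh := ltn_ord y.
    rewrite -(ltn_pmul2r (ltnW p1)) -mE.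
    have : x ^ 2 <= h ^ 2 by rewrite leq_exp2r.
    have : y ^ 2 <= h ^ 2 by rewrite leq_exp2r.
    rewrite ph; nia.
case: u v uv Fuv => [x|x] [y|y] uv Fuv.
- by move: uv; rewrite (sqr_inj x y Fuv) eqxx.
- exact: cross Fuv.
- by apply: cross (esym Fuv).
- move: uv; have /sqr_inj -> : (x%:R ^+ 2 = y%:R ^+ 2 :> 'F_p)%R.
    by apply: oppr_inj; apply: (addrI (-1)%R).
  by rewrite eqxx.
Qed.

(** Equivalently, [n] is a sum of four rational squares with common denominator [c]; the denominator
    makes the property stable under cancelling a nonzero square. *)
Definition scaled_sum4 (n : int) : Prop :=
  exists c a b d e : int,
    c <> 0%R /\ (c * c * n = a * a + b * b + d * d + e * e)%R.

(* Euler's four-square identity. *)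
Lemma scaled_sum4_mul (m n : int) :
  scaled_sum4 m -> scaled_sum4 n -> scaled_sum4 (m * n)%R.
Proof.
move=> [c [x1 [x2 [x3 [x4 [c0 cE]]]]]] [c' [y1 [y2 [y3 [y4 [c'0 cE']]]]]].
exists (c * c')%R, (x1 * y1 + x2 * y2 + x3 * y3 + x4 * y4)%R,
  (x1 * y2 - x2 * y1 + x3 * y4 - x4 * y3)%R,
  (x1 * y3 - x2 * y4 - x3 * y1 + x4 * y2)%R,
  (x1 * y4 + x2 * y3 - x3 * y2 - x4 * y1)%R.
split; first by move/eqP; rewrite mulf_eq0 => /orP[] /eqP.
transitivity ((c * c * m) * (c' * c' * n))%R; first by ring.
by rewrite cE cE'; ring.
Qed.

Lemma scaled_sum4_cancel (m n : int) :
  m <> 0%R -> scaled_sum4 (m * m * n)%R -> scaled_sum4 n.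
Proof.
move=> m0 [c [a [b [d [e [c0 cE]]]]]]; exists (c * m)%R, a, b, d, e.
split; first by move/eqP; rewrite mulf_eq0 => /orP[] /eqP.
by rewrite -cE; ring.
Qed.

(* Allowing a square factor turns the descent in Lagrange's theorem into an
   induction: for a prime p, write m p = x^2 + y^2 + 1 with m < p; then
   m^2 p = m (m p) is a product of two scaled sums of four squares. *)
Lemma scaled_sum4_nat (n : nat) : scaled_sum4 (Posz n).
Proof.
elim/ltn_ind: n => n IH.
have [n1|n1] := leqP n 1.
  exists 1%R, (Posz n), 0%R, 0%R, 0%R; split=> //.
  by case: n n1 {IH} => [|[|]].
have [pr_n|npr] := boolP (prime n).
  have [x [y [m [m0 mn mE]]]] := prime_dvd_sum2_succ pr_n.
  apply: (@scaled_sum4_cancel (Posz m)); first by lia.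
  rewrite -mulrA; apply: scaled_sum4_mul; first exact: IH.
  exists 1%R, (Posz x), (Posz y), 1%R, 0%R; split=> //.
  by rewrite -PoszM mE; lia.
have [d [d1 dn dvd_dn]] : exists d, [/\ 1 < d, d < n & d %| n].
  exists (pdiv n); split; [exact/prime_gt1/pdiv_prime| |exact: pdiv_dvd].
  rewrite ltn_neqAle pdiv_leq ?(ltnW n1) // andbT.
  by apply: contra npr => /eqP <-; exact: pdiv_prime.
rewrite -(divnK dvd_dn) PoszM; apply: scaled_sum4_mul; last exact: IH.
by apply: IH; rewrite ltn_Pdiv // ltnW.
Qed.

(** This makes the natural numbers first-order definable in the ring of integers. *)
Lemma scaled_sum4_ge0 (n : int) : scaled_sum4 n <-> (0 <= n)%R.
Proof.
split=> [[c [a [b [d [e [/eqP c0 cE]]]]]]|].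
  have c2 : (0 < c * c)%R by rewrite -expr2 exprn_even_gt0.
  by rewrite -(pmulr_rge0 _ c2) cE -!expr2 !addr_ge0 // sqr_ge0.
by case: n => // n _; exact: scaled_sum4_nat.
Qed.

(** * Arithmetic in the ring of integers *)

Fixpoint term_rename (L : signature) (V W : Type) (s : V -> W) (t : term L V) :
    term L W :=
  match t with
  | Var x => Var (s x)
  | App f ts => App f (fun j => term_rename s (ts j))
  end.

(** Moves the variables of the table formulas to the pairs used by an interpretation. [W] is
    quantified after [phi] because both variable types grow under a quantifier. *)
Fixpoint formula_rename (L : signature) (V : Type) (phi : formula L V) :
    forall W : Type, (V -> W) -> formula L W :=
  match phi with
  | Bot => fun W s => Bot
  | Eq t u => fun W s => Eq (term_rename s t) (term_rename s u)
  | Rel r ts => fun W s => Rel r (fun j => term_rename s (ts j))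
  | Imp p q => fun W s => Imp (formula_rename p s) (formula_rename q s)
  | All p => fun W s => All (formula_rename p (omap s))
  end.

Lemma eval_rename (L : signature) (M : structure L) (V W : Type) (s : V -> W)
    (v : W -> M) (t : term L V) : eval v (term_rename s t) = eval (v \o s) t.
Proof. by elim: t => //= f ts IH; congr fint; apply/funext. Qed.

Lemma sat_rename (L : signature) (M : structure L) (V : Type)
    (phi : formula L V) (W : Type) (s : V -> W) (v : W -> M) :
  sat (formula_rename phi s) v <-> sat phi (v \o s).
Proof.
elim: phi W s v => {V} [V|V t u|V r ts|V p IHp q IHq|V p IHp] W s v //=.
- by rewrite !eval_rename.
- by under eq_fun do rewrite eval_rename.
- by rewrite IHp IHq.
- have E a : (fun x => if x is Some y then v y else a) \o omap s =
    fun x => if x is Some y then v (s y) else a by apply/funext; case.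
  by split=> H a; move/(_ a): H; rewrite IHp E.
Qed.

(** * Defining the natural numbers in the ring of integers *)

Definition Conj (L : signature) (V : Type) (p q : formula L V) : formula L V :=
  Imp (Imp p (Imp q Bot)) Bot.

Definition Exs (L : signature) (V : Type) (p : formula L (option V)) :
    formula L V := Imp (All (Imp p Bot)) Bot.

Lemma sat_Conj (L : signature) (M : structure L) (V : Type)
    (p q : formula L V) (v : V -> M) :
  sat (Conj p q) v <-> sat p v /\ sat q v.
Proof.
split=> /= [npq|[sp sq]]; last by apply.
by split; apply: contrapT => n; apply: npq.
Qed.

Lemma sat_Exs (L : signature) (M : structure L) (V : Type)
    (p : formula L (option V)) (v : V -> M) :
  sat (Exs p) v <->
  exists a : M, sat p (fun x => if x is Some y then v y else a).
Proof.
split=> /= [np|[a pa]]; last by move/(_ a).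
by apply: contrapT => n; apply: np => a pa; apply: n; exists a.
Qed.

(* At a constant symbol the two arguments are not used. *)
Definition arith_app (V : Type) (o : arith_op) (t u : term arith_sig V) :
    term arith_sig V :=
  @App arith_sig V o (fun j => if val j == 0 then t else u).

(** Expresses [scaled_sum4]. From the outside the quantifiers bind [c], [a], [b], [d], [e]; each
    [Some] skips one binder. *)
Definition nonneg_formula (V : Type) (x : V) : formula arith_sig V :=
  let mul := arith_app Mul in let add := arith_app Add in
  let c := Var (Some (Some (Some (Some None)))) in
  let a := Var (Some (Some (Some None))) in
  let b := Var (Some (Some None)) in
  let d := Var (Some None) in
  let e := Var None in
  let n := Var (Some (Some (Some (Some (Some x))))) in
  Exs (Exs (Exs (Exs (Exs (Conj
    (Imp (Eq c (arith_app Zero c c)) Bot)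
    (Eq (mul (mul c c) n)
        (add (add (add (mul a a) (mul b b)) (mul d d)) (mul e e)))))))).

Lemma sat_nonneg (V : Type) (x : V) (v : V -> intS) :
  sat (nonneg_formula x) v <-> (0 <= v x :> int)%R.
Proof.
rewrite -scaled_sum4_ge0; split.
- by do 5 case/sat_Exs => ?; case/sat_Conj => /= nz E; do 5 eexists; split; eauto.
- case=> c [a [b [d [e [nz E]]]]].
  apply/sat_Exs; exists c; apply/sat_Exs; exists a; apply/sat_Exs; exists b.
  apply/sat_Exs; exists d; apply/sat_Exs; exists e.
  by apply/sat_Conj.
Qed.

(** * Relativization of quantifiers to the natural numbers *)

Fixpoint relativize (V : Type) (phi : formula arith_sig V) :
    formula arith_sig V :=
  match phi with
  | Bot => Bot
  | Eq t u => Eq t u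
  | Rel r ts => Rel r ts
  | Imp p q => Imp (relativize p) (relativize q)
  | All p => All (Imp (nonneg_formula None) (relativize p))
  end.

Lemma eval_int (V : Type) (v : V -> nat) (t : term arith_sig V) :
  eval (M := intS) (fun x => Posz (v x)) t = Posz (eval (M := natS) v t).
Proof.
elim: t => //= -[] ts IH //=; first by rewrite !IH PoszD.
by rewrite !IH PoszM.
Qed.

(** [Posz] embeds the semiring of naturals onto the nonnegative integers, so a guarded quantifier
    over the integers ranges exactly over the image of the naturals. *)
Lemma sat_relativize (V : Type) (phi : formula arith_sig V) (v : V -> nat) :
  sat (M := intS) (relativize phi) (fun x => Posz (v x)) <->
  sat (M := natS) phi v.
Proof.
elim: phi v => {V} [V|V t u|V []|V p IHp q IHq|V p IHp] v //.
- by rewrite /= !eval_int; split=> [[]|->].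
- by rewrite /= IHp IHq.
have E n : (fun x => if x is Some y then Posz (v y) else Posz n) =
    fun x => Posz (if x is Some y then v y else n) by apply/funext; case.
have allE : sat (M := intS) (relativize (All p)) (fun x => Posz (v x)) <->
    forall a : int, (0 <= a)%R -> sat (M := intS) (relativize p)
      (fun x => if x is Some y then Posz (v y) else a).
  split=> H a; first by move=> a0; apply: (H a); exact/sat_nonneg.
  by move=> /sat_nonneg; exact: H.
rewrite allE; split=> [H n|H [n|//] _]; first by apply/IHp; rewrite -E; exact: H.
by rewrite E; apply/IHp; exact: H.
Qed.

(** * Gödel numbers as coordinates *)

Lemma arithmetic_absolutely_interpretable (L : signature) (A : structure L) :
  arithmetic_multiplication_table A ->
  exists G : interpretation L arith_sig, absolute_interpretation G A intS.
Proof.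
case=> m [g [gen [[phiE phiEP] defF defR]]].
pose phiF f := sval (cid (defF f)); have phiFP f : forall v, sat (phiF f) v <-> _ := svalP (cid (defF f)).
pose phiR r := sval (cid (defR r)); have phiRP r : forall v, sat (phiR r) v <-> _ := svalP (cid (defR r)).
(* A number codes a term exactly when it is related to itself by [phiE], so identifying the two
   variables of [phiE] defines the domain. *)
pose G : interpretation L arith_sig := @Interpretation L arith_sig 1
  (Conj (nonneg_formula ord0)
        (relativize (formula_rename phiE (fun _ : bool => ord0))))
  (relativize (formula_rename phiE (fun b => (b, ord0))))
  (fun f => relativize (formula_rename (phiF f) (fun o => (o, ord0))))
  (fun r => relativize (formula_rename (phiR r) (fun j => (j, ord0)))).
exists G.
have domP (x : 'I_1 -> intS) :
    sat (dom G) x <-> exists t : term L 'I_m, x = fun=> Posz (godel t).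
  rewrite sat_Conj sat_nonneg; split=> [[x0 xE]|[t ->]].
    have xabs : x = fun k => Posz `|(x k : int)|%N.
      by apply/funext => k; rewrite (ord1 k) gez0_abs.
    move: xE; rewrite xabs sat_relativize sat_rename => /phiEP [s [t [sE _ _]]].
    by exists s; apply/funext => k; rewrite (ord1 k) -sE.
  split=> //; apply/(sat_relativize _ (fun=> godel t))/sat_rename/phiEP.
  by exists t, t.
(* [tm] decodes a coordinate. As [godel] is injective, the terms supplied by the table formulas are
   the decoded ones. *)
have [tm tmP] := choice (fun x : interp_dom G intS => proj1 (domP _) (svalP x)).
have valE (J : Type) (x : J -> interp_dom G intS) :
    interp_val x = fun z => Posz (godel (tm (x z.1))).
  by apply/funext => -[j k]; rewrite /interp_val /= tmP.
apply: (@coordinate_map_interp _ _ G A intS (fun x => eval g (tm x))); split.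
- move=> a; have [t <-] := gen a.
  pose n : 'I_1 -> intS := fun=> Posz (godel t).
  have dn : sat (dom G) n by apply/domP; exists t.
  exists (exist (fun v => sat (dom G) v) n dn); congr eval.
  have := tmP (exist (fun v => sat (dom G) v) n dn).
  by move=> /(congr1 (fun h => h ord0)) [] /godel_inj <-.
- move=> x; rewrite valE sat_relativize sat_rename phiEP /=; split.
    by case=> s [t [/godel_inj -> /godel_inj ->]].
  by move=> E; exists (tm (x false)), (tm (x true)).
- move=> f x; rewrite valE sat_relativize sat_rename phiFP /=; split.
    case=> s [t [sE /godel_inj -> <-]].
    by congr fint; apply/funext => j; rewrite (godel_inj (sE j)).
  by move=> E; exists (fun j => tm (x (Some j))), (tm (x None)).
- move=> r x; rewrite valE sat_relativize sat_rename phiRP /=; split.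
    case=> s [sE]; have -> // : (fun j => eval g (tm (x j))) =
      fun j => eval g (s j) by apply/funext => j; rewrite (godel_inj (sE j)).
  by move=> E; exists (fun j => tm (x j)).
Qed.

(** The first conjunct ensures that the nonstandard model exists; the second treats every
    interpretation [G], so the choice of [G] is immaterial. A coordinate map for [G] lifts to the
    ultrapowers and there yields both the admissibility of [G] and the isomorphism. *)
Theorem theorem6p5 (L : signature) (A : structure L)
    (fgA : finitely_generated A)
    (arithA : arithmetic_multiplication_table A)
    (kappa : Type) (kappa_infinite : infinite_set [set: kappa])
    (gch_kappa : card_successor [set: kappa] [set: set kappa])
    (D : set_system kappa) (UD : UltraFilter D)
    (D_nonprincipal : forall i : kappa, D <> principal_filter i) :
  (exists G : interpretation L arith_sig, absolute_interpretation G A intS) /\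
  (forall G : interpretation L arith_sig, absolute_interpretation G A intS ->
     exists H : interp_admissible G (ultrapower UD intS),
       isomorphic (ultrapower UD A) (interp_structure H)).
Proof.
split=> [|G /interp_coordinate_map [p /(coordinate_map_ultrapower UD) [q]]].
  exact: arithmetic_absolutely_interpretable.
by move=> /coordinate_map_interp [H /isomorphic_sym iso]; exists H.
Qed.
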